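(* Let $E=\left\{\sum_{j=1}^\infty \varepsilon_j 4^{-j} : \varepsilon_j\in\{0,1\}\right\}\subset\mathbb{R}\subset\mathbb{C}$ and $E'=2E+i\subset\mathbb{C}$. Then the union of all line segments joining a point of $E$ to a point of $E'$, $$B=\{(1-h)z+hz' : z\in E,\ z'\in E',\ 0\le h\le 1\}\subset\mathbb{C},$$ is a Besicovitch set in the following (wide) sense: $B$ has two-dimensional Lebesgue measure zero, and $B$ contains line segments in all directions belonging to some nonempty open set of directions.
   Context: The plane $\mathbb{R}^2$ is identified with $\mathbb{C}$, and $i$ is the imaginary unit. A Besicovitch set in the wide sense in $\mathbb{R}^n$ is a set of $n$-dimensional Lebesgue measure zero which contains (nondegenerate) line segments in all directions belonging to a nonempty open set of directions. *)

(* Defs.v *)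
From HB Require Import structures.
From mathcomp Require Import all_boot all_order all_algebra.
From mathcomp Require Import all_classical all_reals all_analysis.
From mathcomp Require Import complex.

Set Implicit Arguments.
Unset Strict Implicit.
Unset Printing Implicit Defensive.

Import Order.TTheory GRing.Theory Num.Theory.
Import numFieldNormedType.Exports.

Local Open Scope classical_set_scope.
Local Open Scope ring_scope.
Local Open Scope complex_scope.

(** [R[i]] carries no measurable structure, so a subset of the complex plane
    is transported to [R * R] along [(x, y) |-> x + i y].  Negligible means:
    contained in a Borel set of measure zero, which is exactly being
    Lebesgue-null. *)
Definition planar_null (R : realType) (A : set R[i]) : Prop :=
  (@lebesgue_measure R \x @lebesgue_measure R)%E.-negligible
    [set p : R * R | A (p.1 +i* p.2)].

Definition segment (R : realType) (z w : R[i]) : set R[i] :=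
  [set (1 - h%:C) * z + h%:C * w | h in [set h : R | 0 <= h <= 1]].

(** Directions are unit complex numbers. *)
Definition unit_circle (R : realType) : set R[i] := [set u | `|u| = 1].

(** Relatively open subsets of the unit circle; [R[i]^o] is [R[i]] with the
    topology of the modulus. *)
Definition open_directions (R : realType) (U : set R[i]) : Prop :=
  exists2 V : set R[i]^o, open V & U = V `&` @unit_circle R.

(** Since [u] is a unit vector, [r > 0] makes the segment nondegenerate. *)
Definition contains_segment_in_direction (R : realType)
    (A : set R[i]) (u : R[i]) : Prop :=
  exists z w : R[i],
    (exists2 r : R, 0 < r & w - z = r%:C * u) /\ segment z w `<=` A.

Definition wide_besicovitch (R : realType) (A : set R[i]) : Prop :=
  planar_null A /\
  exists U : set R[i],
    [/\ open_directions U, U !=set0 &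
        forall u, U u -> contains_segment_in_direction A u].

Definition setE_real (R : realType) : set R :=
  [set x | exists eps : nat -> bool,
     (fun n : nat => \sum_(1 <= j < n.+1) (eps j)%:R * 4 ^- j) @ \oo --> x].

Definition setE (R : realType) : set R[i] :=
  [set x%:C | x in @setE_real R].

Definition setE' (R : realType) : set R[i] :=
  [set 2 * z + 'i%C | z in @setE R].

Definition setB (R : realType) : set R[i] :=
  [set v | exists z z' : R[i], exists h : R,
     [/\ setE z, setE' z', 0 <= h <= 1 &
         v = (1 - h%:C) * z + h%:C * z']].

(* Main.v *)
(** For [z = x] in [E] and [z' = 2 y + i] in [E'], the segment from [z] to [z']
    has direction [2 y - x + i], and [2 E - E] is the whole interval [-1/3, 2/3].

    The slice of [B] at height [h] is [K = p E + q E] with [p = 1 - h] and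
    [q = 2 h], a union of [4 ^ k] translates of [4 ^ - k K].  The idea, due to
    Peres, Simon and Solomyak, is that if two such pieces of a common level can
    be made arbitrarily close relative to their size, then they overlap almost
    completely and [K] must be null.  For fixed [e], the levels [h] at which no
    two pieces are [e]-close form a porous, hence null, set: the offset between
    two pieces is affine in [h], and suitable pairs of pieces coincide at
    levels close to any given [h], at every scale.  Fubini's theorem then gives
    the measure of [B].

    All sets of reals are measured by their Jordan outer content, so that no
    measurability is needed until the last step. *)
Require Import Defs.
From mathcomp Require Import all_boot all_order all_algebra.
From mathcomp Require Import all_classical all_reals all_analysis.
From mathcomp Require Import complex.
From mathcomp Require Import measurable_realfun ring lra.

Set Implicit Arguments.
Unset Strict Implicit.
Unset Printing Implicit Defensive.

Import Order.TTheory GRing.Theory Num.Theory.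
Import numFieldNormedType.Exports.

Local Open Scope classical_set_scope.
Local Open Scope ring_scope.

(** * Finite interval covers and sets of content zero *)

Section Covers.
Variable R : realType.
Implicit Types (A B : set R) (m c d u v : R).

Definition covered A m : Prop := exists s : seq (R * R),
  [/\ all (fun i => 0 <= i.2) s,
      A `<=` [set x | has (fun i => i.1 <= x <= i.1 + i.2) s] &
      \sum_(i <- s) i.2 <= m].

Lemma covered_sub A B m : A `<=` B -> covered B m -> covered A m.
Proof. by move=> AB [s [s0 Bs sm]]; exists s; split=> // x /AB /Bs. Qed.

Lemma covered_le A m1 m2 : m1 <= m2 -> covered A m1 -> covered A m2.
Proof. by move=> le_m [s [s0 As sm]]; exists s; split=> //; apply: le_trans le_m. Qed.

Lemma covered_ge0 A m : covered A m -> 0 <= m.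
Proof.
move=> [s [/allP s0 _ sm]]; apply: le_trans sm.
by rewrite big_seq; apply: sumr_ge0 => i /s0.
Qed.

Lemma covered_set0 : covered set0 0.
Proof. by exists [::]; split=> //; rewrite big_nil. Qed.

Lemma coveredU A B m1 m2 : covered A m1 -> covered B m2 -> covered (A `|` B) (m1 + m2).
Proof.
move=> [s [s0 As sm]] [t [t0 Bt tm]]; exists (s ++ t); split.
- by rewrite all_cat s0 t0.
- by move=> x [/As|/Bt] /= xst; rewrite has_cat xst ?orbT.
- by rewrite big_cat lerD.
Qed.

Lemma covered_itv u v : u <= v -> covered [set x | u <= x <= v] (v - u).
Proof.
move=> uv; exists [:: (u, v - u)]; split=> /=.
- by rewrite subr_ge0 uv.
- by move=> x /= xuv; rewrite addrC subrK xuv.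
- by rewrite big_seq1.
Qed.

Lemma covered_affine A m c d : 0 <= c -> covered A m ->
  covered [set c * x + d | x in A] (c * m).
Proof.
move=> c0 [s [/allP s0 As sm]].
exists [seq (c * i.1 + d, c * i.2) | i <- s]; split.
- by apply/allP => _ /mapP[i /s0 i0 ->] /=; rewrite mulr_ge0.
- move=> _ [x /As /hasP[i si /andP[ix xi]] <-] /=.
  apply/hasP; exists (c * i.1 + d, c * i.2); first exact: map_f.
  have := ler_wpM2l c0 ix; have := ler_wpM2l c0 xi; rewrite mulrDr /=; lra.
- by rewrite big_map -mulr_sumr ler_wpM2l.
Qed.

(** Each interval of a finite cover grows by [2 * d]. The point is that [N] is independent of [d],
    which can thus be chosen after it. *)
Lemma covered_thicken A m : covered A m -> exists2 N : R, 0 < N &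
  forall d, 0 <= d ->
    covered [set x | exists2 y, A y & `|x - y| <= d] (m + N * d).
Proof.
move=> [s [/allP s0 As sm]]; exists (2 * (size s)%:R + 1).
  by rewrite ltr_wpDl // mulr_ge0 // ler0n.
move=> d d0; exists [seq (i.1 - d, i.2 + 2 * d) | i <- s]; split.
- by apply/allP => _ /mapP[i /s0 i0 ->] /=; lra.
- move=> x [y /As /hasP[i si /andP[iy yi]]]; rewrite ler_norml => /andP[xy yx] /=.
  apply/hasP; exists (i.1 - d, i.2 + 2 * d).
    exact: (map_f (fun i => (i.1 - d, i.2 + 2 * d))).
  by move=> /=; lra.
- rewrite big_map /= big_split /= big_const_seq count_predT iter_addr_0.
  rewrite -mulr_natl; have : 0 <= (size s)%:R :> R by apply: ler0n.
  nra.
Qed.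

Lemma covered_bigcup (T : eqType) (s : seq T) (F : T -> set R) m :
  (forall i, i \in s -> covered (F i) m) ->
  covered [set x | exists2 i, i \in s & F i x] ((size s)%:R * m).
Proof.
elim: s => [|i s IHs] sF.
  by rewrite mul0r; apply: covered_sub covered_set0 => x [].
rewrite /= -add1n natrD mulrDl mul1r; apply: covered_sub (coveredU (sF i _) (IHs _)).
- move=> x [j]; rewrite inE => /orP[/eqP-> |js] Fx; [by left|by right; exists j].
- by rewrite inE eqxx.
- by move=> j js; apply: sF; rewrite inE js orbT.
Qed.

(** Cutting the hole out of [[u, v]] leaves two intervals of total length at most
    [(1 - c) * (v - u)]; the bound is linear in the length, so the covers given by induction add
    up. *)
Lemma covered_porous (G : set R) (u0 v0 c : R) : 0 < c -> c <= 1 ->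
  (forall u v, u0 <= u -> u < v -> v <= v0 -> exists u' v',
     [/\ u <= u', u' <= v', v' <= v, c * (v - u) <= v' - u' &
         forall x, G x -> ~ (u' < x < v')]) ->
  forall k u v, u0 <= u -> u <= v -> v <= v0 ->
  covered (G `&` [set x | u <= x <= v]) ((1 - c) ^+ k * (v - u)).
Proof.
move=> c0 c1 holeG; elim=> [|k IHk] u v u0u uv vv0.
  rewrite expr0 mul1r; apply: covered_sub (covered_itv uv); exact: subIsetr.
have [uv'|] := ltP u v; last first.
  move=> vu; have -> : v = u by lra.
  rewrite subrr mulr0; have := covered_itv (lexx u); rewrite subrr.
  by apply: covered_sub; apply: subIsetr.
have [u' [v' [uu' u'v' v'v huv hG]]] := holeG u v u0u uv' vv0.
have c1k : 0 <= (1 - c) ^+ k by apply: exprn_ge0; lra.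
apply: (@covered_le _ ((1 - c) ^+ k * (u' - u) + (1 - c) ^+ k * (v - v'))).
  by rewrite exprSr -mulrDr -mulrA; apply: ler_wpM2l => //; lra.
apply: covered_sub (coveredU (IHk u u' _ _ _) (IHk v' v _ _ _)); try lra.
move=> x [Gx /= /andP[ux xv]]; have [xu'|u'x] := leP x u'.
  by left; split=> //=; rewrite ux.
right; split=> //=; rewrite xv andbT leNgt; apply/negP => xv'.
by apply: (hG x Gx); rewrite u'x.
Qed.

Definition content_zero A := forall e : R, 0 < e -> covered A e.

Lemma content_zero_porous (G : set R) (u0 v0 c : R) : u0 <= v0 -> 0 < c -> c <= 1 ->
  (forall u v, u0 <= u -> u < v -> v <= v0 -> exists u' v',
     [/\ u <= u', u' <= v', v' <= v, c * (v - u) <= v' - u' &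
         forall x, G x -> ~ (u' < x < v')]) ->
  content_zero (G `&` [set x | u0 <= x <= v0]).
Proof.
move=> uv0 c0 c1 holeG e e0.
(* The [+ 1] keeps the denominator positive when [u0 = v0]. *)
have /cvgrPdist_lt /(_ (e / (v0 - u0 + 1))) : (1 - c) ^+ k @[k --> \oo] --> (0 : R).
  by apply: cvg_expr; rewrite ger0_norm; lra.
case=> [|k _ /(_ k (leqnn k))]; first by apply: divr_gt0 => //; lra.
rewrite sub0r normrN ger0_norm; last by apply: exprn_ge0; lra.
rewrite ltr_pdivlMr; last lra.
move=> lt_e; apply: covered_le (covered_porous c0 c1 holeG k (lexx _) uv0 (lexx _)).
have : 0 <= (1 - c) ^+ k by apply: exprn_ge0; lra.
nra.
Qed.

End Covers.

(** * The Cantor set [E] and its digit expansions *)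

Section CantorSet.
Variable R : realType.
Local Notation E := (@setE_real R).

Lemma setE_real_cons (b : bool) (y : R) : E y -> E ((b%:R + y) / 4).
Proof.
(* Digits are numbered from 1, so [b] becomes digit 1; the value at 0 is never read. *)
move=> [eps epsy]; exists (fun n => if n is m.+2 then eps m.+1 else b).
rewrite -(cvg_shiftS (fun n => \sum_(1 <= j < n.+1) _)).
rewrite [X in X @ _ --> _](_ : _ =
    fun n => (b%:R + \sum_(1 <= j < n.+1) (eps j)%:R * 4 ^- j) / 4); last first.
  apply/funext => n; rewrite [LHS]big_nat_recl //= expr1 mulrDl; congr (_ + _).
  rewrite mulr_suml; apply: eq_big_nat => -[|j] //= _.
  by rewrite [in LHS]exprS invfM; ring.
by apply: cvgMl; apply: cvgD => //; apply: cvg_cst.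
Qed.

Lemma setE_real_uncons (x : R) : E x ->
  exists b : bool, exists2 y, E y & x = (b%:R + y) / 4.
Proof.
move=> [eps epsx]; exists (eps 1%N), (4 * x - (eps 1%N)%:R); last by field.
exists (fun n => eps n.+1).
rewrite [X in X @ _ --> _](_ : _ =
    fun n => 4 * (\sum_(1 <= j < n.+2) (eps j)%:R * 4 ^- j) - (eps 1%N)%:R); last first.
  apply/funext => n; rewrite [X in 4 * X]big_nat_recl //= expr1 mulrDr [4 * (_ / 4)]mulrC.
  rewrite divfK ?pnatr_eq0 // addrC addKr mulr_sumr.
  apply: eq_bigr => j _; rewrite [in RHS]exprS invfM mulrCA mulVKf ?pnatr_eq0 //.
apply: cvgB; last exact: cvg_cst.
apply: cvgMr.
by rewrite (cvg_shiftS (fun n => \sum_(1 <= j < n.+1) (eps j)%:R * 4 ^- j : R)).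
Qed.

Lemma quaternary_sum_ge0 (eps : nat -> bool) n :
  0 <= \sum_(1 <= j < n.+1) (eps j)%:R * 4 ^- j :> R.
Proof. by apply: sumr_ge0 => j _; rewrite mulr_ge0 ?ler0n ?invr_ge0 ?exprn_ge0. Qed.

Lemma quaternary_sum_le (eps : nat -> bool) n :
  \sum_(1 <= j < n.+1) (eps j)%:R * 4 ^- j <= 3^-1 :> R.
Proof.
have inv_ge0 k : 0 <= 4 ^- k :> R by rewrite invr_ge0 exprn_ge0.
suff : \sum_(1 <= j < n.+1) (eps j)%:R * 4 ^- j <= (1 - 4 ^- n) / 3 :> R.
  by have := inv_ge0 n; lra.
elim: n => [|n IHn]; first by rewrite big_geq // expr0 invr1 subrr mul0r.
rewrite big_nat_recr //=.
have : (eps n.+1)%:R * 4 ^- n.+1 <= 4 ^- n.+1 :> R.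
  by rewrite ler_piMl // lern1; case: (eps _).
by move: IHn; rewrite exprS invfM /=; lra.
Qed.

Lemma setE_real_series (eps : nat -> bool) : exists2 x : R, E x &
  (fun n : nat => \sum_(1 <= j < n.+1) (eps j)%:R * 4 ^- j) @ \oo --> x.
Proof.
set u := fun n : nat => _.
have nd : nondecreasing_seq u.
  apply/nondecreasing_seqP => n; rewrite /u [leRHS]big_nat_recr //= lerDl.
  by rewrite mulr_ge0 // ?ler0n // invr_ge0 exprn_ge0.
have cu : cvgn u.
  apply: nondecreasing_is_cvgn => //; exists 3^-1 => _ [n _ <-].
  exact: quaternary_sum_le.
by exists (limn u) => //; exists eps.
Qed.

Lemma setE_real_itv (x : R) : E x -> 0 <= x <= 1.
Proof.
move=> [eps epsx]; apply/andP; split.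
  apply: (cvgr_to_ge epsx); apply: nearW => n.
  exact: quaternary_sum_ge0.
apply: (cvgr_to_le epsx); apply: nearW => n.
by apply: le_trans (quaternary_sum_le eps n) _; lra.
Qed.

Lemma setE_real0 : E 0.
Proof.
exists (fun=> false).
rewrite (_ : (fun n => _) = cst 0); first exact: cvg_cst.
by apply/funext => n; rewrite big1 // => j _; rewrite mul0r.
Qed.

End CantorSet.

(** * The difference set [2E - E] is an interval *)

Section Directions.
Variable R : realType.
Local Notation E := (@setE_real R).

(* Digits of the greedy expansion of a point of [2E - E = [-1/3, 2/3]] in base
   4 with digits [2 g - f], i.e. -1, 0, 1, 2. *)
Let f (t : R) : bool := (4 * t < - 3^-1) || (2 / 3 <= 4 * t < 5 / 3).
Let g (t : R) : bool := 2 / 3 <= 4 * t.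
Let next (t : R) : R := 4 * t - (2 * (g t)%:R - (f t)%:R).

(** The intervals [d + [-1/3, 2/3]], [d = -1, 0, 1, 2], cover [4 [-1/3, 2/3]], so the remainders
    [u n] stay in [[-1/3, 2/3]] and [4 ^- n * u n] tends to 0. *)
Lemma setE_real_diff (t : R) : - 3^-1 <= t <= 2 / 3 ->
  exists x y, [/\ E x, E y & t = 2 * y - x].
Proof.
move=> t01; pose u n := iter n next t.
have u01 n : - 3^-1 <= u n <= 2 / 3.
  elim: n => [//|n]; rewrite /u iterS -/(u n) /next /f /g; move: (u n) => s s01.
  by case: (ltP (4 * s) (- 3^-1)) => h1; case: (leP (2 / 3) (4 * s)) => h2;
     case: (ltP (4 * s) (5 / 3)) => h3 /=; lra.
have [x Ex xlim] := setE_real_series R (fun n => f (u n.-1)).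
have [y Ey ylim] := setE_real_series R (fun n => g (u n.-1)).
exists x, y; split=> //.
have ut n : t = 2 * (\sum_(1 <= j < n.+1) (g (u j.-1))%:R * 4 ^- j)
    - \sum_(1 <= j < n.+1) (f (u j.-1))%:R * 4 ^- j + 4 ^- n * u n.
  elim: n => [|n IHn].
    by rewrite !big_geq // expr0 invr1 mulr0 subrr add0r mul1r.
  rewrite {1}IHn !(big_nat_recr n.+1) //= -/(u n) /next exprS invfM.
  by field; rewrite expf_neq0.
have lim0 : 4 ^- n * u n @[n --> \oo] --> (0 : R).
  have geo : 4 ^- n @[n --> \oo] --> (0 : R).
    rewrite (_ : (fun n => _) = GRing.exp (4^-1 : R)).
      by apply: cvg_expr; rewrite ger0_norm ?invr_ge0 //; lra.
    by apply/funext => n; rewrite exprVn.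
  apply: (@squeeze_cvgr _ _ _ _ (fun n => - 4 ^- n) (fun n => 4 ^- n)) => //.
    apply: nearW => n; have : 0 <= 4 ^- n :> R by rewrite invr_ge0 exprn_ge0.
    by have := u01 n; nra.
  by rewrite -oppr0; apply: cvgN.
have : t @[n --> \oo] --> 2 * y - x + 0.
  rewrite (_ : (fun=> t) = fun n => 2 * (\sum_(1 <= j < n.+1) (g (u j.-1))%:R * 4 ^- j)
    - \sum_(1 <= j < n.+1) (f (u j.-1))%:R * 4 ^- j + 4 ^- n * u n); last first.
    by apply/funext => n; apply: ut.
  by apply: cvgD => //; apply: cvgB => //; apply: cvgMr.
by rewrite addr0 => /(cvg_lim _) => <- //; apply/esym; apply: lim_cst.
Qed.

End Directions.

(** * Integers with base 4 digits 0 and 1; greedy choice of digits *)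

Section Digits.
Variable R : realType.
Local Notation E := (@setE_real R).

(** The integers below [4 ^ k] with all base 4 digits in [{0, 1}]: they index the pieces of [E] of
    level [k]. *)
Fixpoint base4 k : seq nat :=
  if k is k'.+1 then [seq (4 * a + e)%N | a <- base4 k', e <- [:: 0; 1]%N]
  else [:: 0%N].

Lemma size_base4 k : size (base4 k) = (2 ^ k)%N.
Proof. by elim: k => // k IHk; rewrite expnSr -IHk; apply: size_allpairs. Qed.

Lemma base4S k a (b : bool) : a \in base4 k -> (4 * a + b)%N \in base4 k.+1.
Proof.
by move=> ka; apply/allpairsP; exists (a, nat_of_bool b); split=> //; case: b.
Qed.

Lemma base4SP k m : reflect (exists2 a, a \in base4 k & exists b : bool, m = (4 * a + b)%N)
  (m \in base4 k.+1).
Proof.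
apply: (iffP idP) => [/allpairsP[[a b] /= [ka + ->]]|[a ka [b ->]]]; last exact: base4S.
by rewrite !inE => /orP[]/eqP->; exists a => //; [exists false|exists true].
Qed.

Lemma base4_widen k a : a \in base4 k -> a \in base4 k.+1.
Proof.
elim: k a => [|k IHk] a; first by rewrite inE => /eqP ->.
by case/base4SP => b /IHk kb [e ->]; apply: base4S.
Qed.

Lemma base4_shift j k a : a \in base4 k -> (4 ^ j * a)%N \in base4 (j + k).
Proof.
move=> ka; elim: j => [|j IHj]; first by rewrite expn0 mul1n.
by have := base4S false IHj; rewrite addn0 mulnA -expnS.
Qed.

Lemma base4_monotone j k a : a \in base4 k -> a \in base4 (j + k).
Proof. by move=> ka; elim: j => // j; apply: base4_widen. Qed.

Lemma setE_real_base4 k a y : a \in base4 k -> E y -> E ((a%:R + y) / 4 ^+ k).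
Proof.
elim: k a y => [|k IHk] a y; first by rewrite inE => /eqP->; rewrite add0r expr0 divr1.
case/base4SP => b kb [e ->] Ey; have := IHk b _ kb (setE_real_cons e Ey).
congr (E _); rewrite natrD natrM exprS; field.
by rewrite expf_neq0.
Qed.

Lemma setE_real_split k x : E x ->
  exists2 a, a \in base4 k & exists2 y, E y & x = (a%:R + y) / 4 ^+ k.
Proof.
move=> Ex; elim: k => [|k [a ka [y Ey xE]]].
  by exists 0%N; [rewrite inE|exists x => //; rewrite add0r expr0 divr1].
have [b [z Ez yE]] := setE_real_uncons Ey.
exists (4 * a + b)%N; first exact: base4S.
exists z => //; rewrite xE yE natrD natrM exprS; field.
by rewrite expf_neq0.
Qed.

(** Put [r = (p + q) / 3] and, by symmetry, [x >= 0]. Then [4 * x] lies in [[0, p + q + r]], which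
    the intervals of radius [r] about 0, [p], [q], [p + q] cover: the two comparisons of [p] and [q]
    say that both are at most [2 * r]. *)
Lemma greedy_digits (p q x : R) : 0 < p -> 0 < q -> p <= 2 * q -> q <= 2 * p ->
  `|x| <= (p + q) / 3 -> exists e f e' f' : bool,
  `|4 * x + p * (e%:R - f%:R) + q * (e'%:R - f'%:R)| <= (p + q) / 3.
Proof.
move=> p0 q0 pq qp; rewrite ler_norml => xpq.
suff {xpq} H y : 0 <= y -> y <= (p + q) / 3 -> exists f f' e' : bool,
    `|4 * y - p * f%:R + q * (e'%:R - f'%:R)| <= (p + q) / 3.
  have [x0|x0] := leP 0 x.
    have [f [f' [e' H']]] := H x x0 ltac:(lra).
    exists false, f, e', f'; move: H'; congr (`|_| <= _) => /=; ring.
  have [f [f' [e' H']]] := H (- x) ltac:(lra) ltac:(lra).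
  exists f, false, f', e'; move: H'; rewrite -normrN; congr (`|_| <= _) => /=; ring.
move=> y0 yq; setoid_rewrite ler_norml.
have [h1|h1] := leP (4 * y) ((p + q) / 3).
  by exists false, false, false => /=; lra.
have [h2|h2] := leP (4 * y) (q + (p + q) / 3); last first.
  have [h3|h3] := leP (4 * y) (p + (p + q) / 3); last first.
    by exists true, true, false => /=; lra.
  by exists true, false, false => /=; lra.
have [h3|h3] := leP (4 * y) (p + (p + q) / 3); last first.
  by exists false, true, false => /=; lra.
have [h4|h4] := leP (p - (p + q) / 3) (4 * y).
  by exists true, false, false => /=; lra.
by exists false, true, false => /=; lra.
Qed.

(* The lower bound on the second difference is what makes the slope of the
   corresponding affine function of [h] comparable to [4 ^ k]. *)
Lemma close_digits (p q : R) k : 0 < p -> 0 < q -> p <= 2 * q -> q <= 2 * p ->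
  exists a1 a2 b1 b2, [/\ [/\ a1 \in base4 k.+1, a2 \in base4 k.+1,
    b1 \in base4 k.+1 & b2 \in base4 k.+1],
    `|p * (a1%:R - a2%:R) + q * (b1%:R - b2%:R)| <= (p + q) / 3 &
    2 * 4 ^+ k + 1 <= 3 * (b1%:R - b2%:R : R) <= 4 * 4 ^+ k - 1].
Proof.
move=> p0 q0 pq qp; elim: k => [|k [a1 [a2 [b1 [b2 [[ka1 ka2 kb1 kb2] xpq bk]]]]]].
  exists 0%N, 1%N, 1%N, 0%N; split; first by split.
    by rewrite ler_norml; lra.
  by rewrite expr0; lra.
have [e [f [e' [f' step]]]] := greedy_digits p0 q0 pq qp xpq.
exists (4 * a1 + e)%N, (4 * a2 + f)%N, (4 * b1 + e')%N, (4 * b2 + f')%N.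
have digitE (a : nat) (c : bool) : (4 * a + c)%:R = 4 * a%:R + c%:R :> R.
  by rewrite natrD natrM.
split; first by split; apply: base4S.
  by move: step; rewrite !digitE; congr (`|_| <= _); ring.
have bool_itv (c : bool) : (0 <= c%:R :> R) && (c%:R <= 1 :> R) by case: c => /=; lra.
(* The terms [+ 1] and [- 1] of the bounds absorb the new digit difference, as [4 * 1 - 3 = 1]. *)
have := bool_itv e'; have := bool_itv f'; rewrite !digitE exprS; lra.
Qed.

End Digits.

(** * Sumsets [p E + q E] and nearly coinciding pieces *)

Section Sumset.
Variable R : realType.
Local Notation E := (@setE_real R).

Definition sumset (p q : R) : set R :=
  [set z | exists x y, [/\ E x, E y & z = p * x + q * y]].

(** The expression is the offset between two pieces of level [k] divided by their scale [4 ^- k], so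
    [e] measures closeness relative to size, uniformly in [k]. *)
Definition digit_separated (e p q : R) : Prop :=
  forall k a1 a2 b1 b2, a1 \in base4 k -> a2 \in base4 k ->
    b1 \in base4 k -> b2 \in base4 k -> (a1, b1) <> (a2, b2) ->
    e <= `|p * (a1%:R - a2%:R) + q * (b1%:R - b2%:R)|.

Lemma covered_sumset (p q : R) : 0 <= p -> 0 <= q -> covered (sumset p q) (p + q).
Proof.
move=> p0 q0; have := covered_itv (addr_ge0 p0 q0); rewrite subr0.
apply: covered_sub => z [x [y [/setE_real_itv Ex /setE_real_itv Ey ->]]] /=.
by apply/andP; split; nra.
Qed.

(* The [4 ^ k] pieces of [sumset p q] of level [k] have total measure equal to
   that of the whole; two of them almost coincide, which saves a positive
   proportion of one piece. *)
Lemma content_zero_sumset (p q : R) : 0 <= p -> 0 <= q ->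
  (forall e, 0 < e -> ~ digit_separated e p q) -> content_zero (sumset p q).
Proof.
move=> p0 q0 nsep e e0; apply: contrapT => nKe.
set K := sumset p q in nKe *.
pose S := [set M | covered K M].
have hS : has_inf S.
  split; first by exists (p + q); apply: covered_sumset.
  by exists 0 => M; apply: covered_ge0.
have lbS M : covered K M -> inf S <= M by move=> SM; apply: ge_inf => //; apply: hS.2.
have m0 : 0 < inf S.
  apply: lt_le_trans e0 _; apply: lb_le_inf; first exact: hS.1.
  move=> M KM; rewrite leNgt; apply/negP => Me; apply: nKe.
  exact: covered_le (ltW Me) KM.
set m := inf S in lbS m0.
(* The cover [M1] and its constant [N] are fixed first, as they decide how close the pair must be;
   [M2], precise to order [4 ^- k], waits until [k] is known. *)
have [M1 KM1 M1m] := @inf_adherent _ S (m / 4) ltac:(lra) hS.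
have [N N0 thick] := covered_thicken KM1.
have eps0 : 0 < m / (4 * N) by apply: divr_gt0 => //; lra.
have [k [a1 [a2 [b1 [b2 [ka1 ka2 kb1 kb2 [ab tm]]]]]]] : exists k a1 a2 b1 b2,
  [/\ a1 \in base4 k, a2 \in base4 k, b1 \in base4 k, b2 \in base4 k &
   (a1, b1) <> (a2, b2) /\
   `|p * (a1%:R - a2%:R) + q * (b1%:R - b2%:R)| < m / (4 * N)].
  apply: contrapT => H; apply: (nsep _ eps0) => k a1 a2 b1 b2 ? ? ? ? ?.
  by rewrite leNgt; apply/negP => ?; apply: H; exists k, a1, a2, b1, b2.
set t := p * (a1%:R - a2%:R) + q * _ in tm.
have k40 : 0 < 4 ^+ k :> R by apply: exprn_gt0.
have d0 : 0 < m / (4 * 4 ^+ k) by apply: divr_gt0 => //; apply: mulr_gt0.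
have [M2 KM2 M2m] := inf_adherent d0 hS.
(* [K'] contains both [K] and [K] shifted by [- t], so one scaled copy of its cover serves the two
   close pieces. *)
have cK' := thick `|t| (normr_ge0 t).
set K' := [set x | _] in cK'.
pose c (w : nat * nat) : R := p * w.1%:R + q * w.2%:R.
pose W := [seq (a, b) | a <- base4 k, b <- base4 k].
have WP : (a1, b1) \in W by apply/allpairsP; exists (a1, b1).
have WQ : (a2, b2) \in rem (a1, b1) W.
  by apply: rem_mem; [apply/eqP => /esym|apply/allpairsP; exists (a2, b2)].
pose s := rem (a2, b2) (rem (a1, b1) W).
have size_s : (size s)%:R = 4 ^+ k - 2 :> R.
  have sW : size W = ((size s).+2)%N.
    by rewrite (perm_size (perm_to_rem WP)) /= (perm_size (perm_to_rem WQ)).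
  have : (size W)%:R = 4 ^+ k :> R.
    by rewrite size_allpairs size_base4 -expnMn -natrX.
  by rewrite sW -addn2 natrD => <-; ring.
pose aff (A : set R) w : set R := [set (4 ^+ k)^-1 * x + (4 ^+ k)^-1 * c w | x in A].
have k4V0 : 0 <= (4 ^+ k)^-1 :> R by rewrite invr_ge0 ltW.
have cov : covered K ((size s)%:R * ((4 ^+ k)^-1 * M2) + (4 ^+ k)^-1 * (M1 + N * `|t|)).
  apply: covered_sub (coveredU (@covered_bigcup _ _ s (aff K) _ _)
    (covered_affine ((4 ^+ k)^-1 * c (a1, b1)) k4V0 cK')); last first.
    by move=> w _; apply: covered_affine.
  move=> _ [x [y [/(setE_real_split k)[a ka [x' Ex' ->]]
                  /(setE_real_split k)[b kb [y' Ey' ->]] ->]]].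
  have zE : p * ((a%:R + x') / 4 ^+ k) + q * ((b%:R + y') / 4 ^+ k) =
     (4 ^+ k)^-1 * (p * x' + q * y') + (4 ^+ k)^-1 * c (a, b).
    by rewrite /c /=; ring.
  have Kz : K (p * x' + q * y') by exists x', y'.
  have : (a, b) \in W by apply/allpairsP; exists (a, b).
  rewrite (perm_mem (perm_to_rem WP)) inE (perm_mem (perm_to_rem WQ)) inE.
  case/or3P => [/eqP abE|/eqP abE|abs].
  - right; exists (p * x' + q * y'); last by rewrite zE abE.
    by exists (p * x' + q * y') => //; rewrite subrr normr0.
  - right; exists (p * x' + q * y' - t); last first.
      by rewrite zE abE /c /t /=; ring.
    by exists (p * x' + q * y') => //; rewrite addrC addKr normrN.
  - by left; exists (a, b) => //; exists (p * x' + q * y').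
(* Multiplied by [4 ^ k], the cost is below [(4 ^ k - 2) * m + m / 4] for the ordinary pieces plus
   [m + m / 4 + m / 4] for the pair, hence below [4 ^ k * m]. *)
have := lbS _ cov; rewrite leNgt => /negP; apply; rewrite size_s.
have Nt : N * `|t| <= m / 4.
  have := ltW tm; rewrite ler_pdivlMr; last by lra.
  by move=> ?; lra.
rewrite [X in X + _]mulrCA -mulrDr mulrC ltr_pdivrMr //.
have P2 : 0 <= 4 ^+ k - 2 :> R by rewrite -size_s ler0n.
have Pd : 4 ^+ k * (m / (4 * 4 ^+ k)) = m / 4 by field; rewrite expf_neq0.
have := ler_wpM2l P2 (ltW M2m); rewrite mulrDr [(_ - 2) * (m / _)]mulrBl Pd.
lra.
Qed.

End Sumset.

(** * Porosity of the set of separated levels *)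

Section Porosity.
Variable R : realType.

Lemma expr4_unbounded (x : R) : exists k, x <= 4 ^+ k.
Proof.
have [k xk] : exists k : nat, x <= k%:R.
  by exists (Num.bound `|x|); apply: le_trans (ler_norm _) (ltW (archi_boundP _)).
exists k; apply: le_trans xk _; rewrite -natrX ler_nat.
exact: ltnW (ltn_expl k (isT : (1 < 4)%N)).
Qed.

Lemma expr4_bracket (x : R) : 1 <= x -> exists k, x <= 4 ^+ k <= 4 * x.
Proof.
move=> x1; case: (ex_minnP (expr4_unbounded x)) => k xk min_k; exists k.
rewrite xk /=; case: k => [|k] in xk min_k *; first by rewrite expr0; lra.
rewrite exprS ler_pM2l // leNgt; apply/negP => /ltW /min_k.
by rewrite ltnn.
Qed.

Definition level_separated (e : R) : set R := [set h | digit_separated e (1 - h) (2 * h)].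

(* At a level [h] where [s (1 - h)] and [2 s' h] are within a factor 2 of each
   other, greedy digits give an affine function of the level with slope about
   [4 ^ k] and a zero at distance about [4 ^ - k] from [h]. *)
Lemma near_collision (s s' h : R) (k : nat) : 0 < s -> 0 < s' ->
  s <= h * (s + 4 * s') -> h * (s + s') <= s -> 3 / 2 * (s + s') <= s' * 4 ^+ k ->
  exists a1 a2 b1 b2, [/\ a1 \in base4 k.+1, a2 \in base4 k.+1,
    b1 \in base4 k.+1, b2 \in base4 k.+1 & b1 <> b2 /\
  exists g r : R, [/\ 0 < g, g <= 4 * (s + s') * 4 ^+ k,
    s' * 4 ^+ k * `|h - r| <= 3 / 2 * (s + s') & forall x,
    (1 - x) * (s * (a1%:R - a2%:R)) + 2 * x * (s' * (b1%:R - b2%:R)) = g * (x - r)]].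
Proof.
move=> s0 s'0 lowh upph kT.
have h0 : 0 < h by rewrite -(pmulr_lgt0 _ (_ : 0 < s + 4 * s')); lra.
have h1 : h < 1 by rewrite -(ltr_pM2r (_ : 0 < s + s')); lra.
have sh0 : 0 < s * h by apply: mulr_gt0.
have shs : s * h < s by rewrite gtr_pMr.
have s'hs : s' * h < s' by rewrite gtr_pMr.
have pp : 0 < s * (1 - h) by lra.
have qq : 0 < 2 * (s' * h) by rewrite mulr_gt0 // mulr_gt0.
have [a1 [a2 [b1 [b2 [[ka1 ka2 kb1 kb2] f0 bk]]]]] :=
  close_digits k pp qq ltac:(lra) ltac:(lra).
exists a1, a2, b1, b2; split=> //.
set a : R := a1%:R - a2%:R in f0 *; set b : R := b1%:R - b2%:R in f0 bk *.
set P : R := 4 ^+ k in kT bk *; set f := _ + _ in f0; pose T := s + s'.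
have P0 : 0 < P by apply: exprn_gt0.
have b0 : 0 < b by clear -bk P0; lra.
split; first by move=> b12; move: b0; rewrite /b b12 subrr ltxx.
have s'b : s' * (2 * P + 1) <= s' * (3 * b) <= s' * (4 * P - 1).
  by rewrite !ler_pM2l //; clear -bk; lra.
have {}f0 : `|f| <= T by apply: le_trans f0 _; clear -sh0 s'hs s0 s'0; rewrite /T; lra.
(* [g] is the slope of the affine function of the level, and [f] its value at [h]. *)
pose g := 2 * (s' * b) - s * a.
have gE : g * (1 - h) = 2 * (s' * b) - f by rewrite /g /f; ring.
have Ts'b : T <= s' * b by clear -s'b kT s'0; rewrite /T; lra.
have T0 : 0 < T by rewrite /T addr_gt0.
have [f0l f0u] : - T <= f /\ f <= T by move: f0; rewrite ler_norml => /andP.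
have gh0 : s' * b <= g * (1 - h) by rewrite gE; clear -f0u Ts'b; lra.
have g0 : 0 < g.
  rewrite -(pmulr_lgt0 _ (_ : 0 < 1 - h)); last by clear -h1; lra.
  by apply: lt_le_trans gh0; apply: mulr_gt0.
have gl : s' * b <= g.
  by apply: (le_trans gh0); rewrite ler_piMr ?(ltW g0) //; clear -h0; lra.
(* Only [g * (1 - h)] is controlled directly; dividing by [1 - h] costs at most a factor
   [T / s']. *)
have s'T : s' <= (1 - h) * T by clear -upph; rewrite /T; lra.
have gu : g <= 4 * T * P.
  rewrite -(ler_pM2l s'0) mulrC; apply: le_trans (ler_wpM2l (ltW g0) s'T) _.
  rewrite mulrA gE; apply: (@le_trans _ _ (s' * (3 * b) * T)).
    by rewrite ler_pM2r //; clear -f0l Ts'b; lra.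
  rewrite [leRHS](_ : _ = s' * (4 * P) * T); last by ring.
  by rewrite ler_pM2r //; clear -s'b s'0; lra.
exists g, (h - f / g); split=> //.
  rewrite opprB addrC subrK normrM normfV (gtr0_norm g0) mulrA ler_pdivrMr //.
  apply: (@le_trans _ _ (s' * P * T)).
    by rewrite ler_pM2l // mulr_gt0.
  rewrite -/T [leLHS]mulrC [leRHS](_ : _ = T * (3 / 2 * g)); last by ring.
  by rewrite ler_pM2l //; clear -s'b gl s'0; lra.
move=> x; rewrite [RHS](_ : _ = g * (x - h) + g * (f / g)); last by ring.
by rewrite [g * (f / g)]mulrC divfK ?lt0r_neq0 // /g /f; ring.
Qed.

(** The window is the range of [h] allowed by [near_collision] for [s = 4 ^ i], [s' = 4 ^ j].
    Multiplying by these powers shifts digits, so the colliding pieces are genuine ones, of level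
    [i + j + k + 1]. Near the zero [r] their offset is below [e], which makes a hole of length
    proportional to [v - u]. *)
Lemma content_zero_level_separated (e : R) (i j : nat) : 0 < e ->
  content_zero (level_separated e `&`
    [set h | 4 ^+ i / (4 ^+ i + 4 * 4 ^+ j) <= h <= 4 ^+ i / (4 ^+ i + 4 ^+ j)]).
Proof.
move=> e0; set s := 4 ^+ i; set s' := 4 ^+ j.
have s0 : 0 < s :> R by apply: exprn_gt0.
have s'0 : 0 < s' :> R by apply: exprn_gt0.
pose T : R := s + s'.
have T0 : 0 < T by rewrite /T addr_gt0.
pose A : R := 3 / 2 * (T / s').
have A1 : 1 < A.
  have : 1 <= T / s' by rewrite ler_pdivlMr // mul1r lerDr ltW.
  by rewrite /A; lra.
have TA0 : 0 < T * A by apply: mulr_gt0 => //; lra.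
(* The bound [1 / 4] keeps the hole inside [[u, v]]; the other keeps the offset, less than
   [4 * T * 4 ^ k * rho * l] with [4 ^ k * l <= 16 * A], below [e]. *)
pose rho : R := Num.min (1 / 4) (e / (64 * (T * A))).
have rho0 : 0 < rho by rewrite lt_min; apply/andP; split; [lra|apply: divr_gt0; lra].
have rho4 : rho <= 1 / 4 by rewrite ge_min lexx.
have rhoe : 64 * (T * A) * rho <= e.
  by rewrite mulrC -ler_pdivlMr; [rewrite ge_min lexx orbT|lra].
apply: (@content_zero_porous _ _ _ _ (2 * rho)); [| lra | lra |].
  rewrite ler_pdivlMr; last by lra.
  by rewrite mulrC mulrA ler_pdivrMr; nra.
move=> u v u0 uv v0.
pose h := (u + v) / 2; pose l := v - u.
have l0 : 0 < l by rewrite /l; lra.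
have lowh : s <= h * (s + 4 * s') by rewrite -ler_pdivrMr /h; lra.
have upph : h * (s + s') <= s by rewrite -ler_pdivlMr /h; lra.
have u_gt0 : 0 < u by apply: lt_le_trans u0; apply: divr_gt0; lra.
have l1 : l < 1.
  have : v < 1 by apply: le_lt_trans v0 _; rewrite ltr_pdivrMr; lra.
  by rewrite /l; lra.
(* The lower bound puts [r] within [l / 4] of the midpoint; the upper bound limits the slope. *)
have [k /andP[kl ku]] : exists k, 4 * A / l <= 4 ^+ k <= 4 * (4 * A / l).
  by apply: expr4_bracket; rewrite ler_pdivlMr //; lra.
rewrite ler_pdivrMr // in kl; rewrite mulrA ler_pdivlMr // in ku.
have P0 : 0 < 4 ^+ k :> R by apply: exprn_gt0.
have s'A : s' * A = 3 / 2 * T by rewrite /A; field; apply: lt0r_neq0.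
have AP : 3 / 2 * (s + s') <= s' * 4 ^+ k.
  by rewrite -/T -s'A ler_pM2l //; clear -A1 kl l1 P0; nra.
have [a1 [a2 [b1 [b2 [ka1 ka2 kb1 kb2 [b12 [g [r [g0 gu hr gE]]]]]]]]] :=
  near_collision s0 s'0 lowh upph AP.
have {}hr : `|h - r| <= l / 4.
  rewrite -(ler_pM2l P0) -(ler_pM2l s'0) mulrA; apply: (le_trans hr).
  by rewrite -/T -s'A ler_pM2l //; clear -kl; lra.
have rl : rho * l <= l / 4 by rewrite mulrC ler_pM2l //; clear -rho4; lra.
have rl0 : 0 < rho * l by apply: mulr_gt0.
move: hr; rewrite ler_norml => /andP[hrl hru].
exists (r - rho * l), (r + rho * l); split.
- by clear -hrl hru rl; move: hrl hru rl; rewrite /h /l; lra.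
- by clear -rl0; lra.
- by clear -hrl hru rl; move: hrl hru rl; rewrite /h /l; lra.
- by rewrite /l; clear; lra.
move=> x xsep /andP[xl xu].
have shift n m c : c \in base4 k.+1 -> (4 ^ n * c)%N \in base4 (n + (m + k.+1)).
  by move=> kc; apply: base4_shift; apply: base4_monotone.
have shift' n m c : c \in base4 k.+1 -> (4 ^ m * c)%N \in base4 (n + (m + k.+1)).
  by move=> kc; apply: base4_monotone; apply: base4_shift.
have := xsep _ _ _ _ _ (shift i j _ ka1) (shift i j _ ka2)
  (shift' i j _ kb1) (shift' i j _ kb2).
have bneq : (4 ^ i * a1, 4 ^ j * b1)%N <> (4 ^ i * a2, 4 ^ j * b2)%N.
  by case=> _ /eqP; rewrite eqn_pmul2l ?expn_gt0 // => /eqP.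
move=> /(_ bneq); rewrite !natrM !natrX -!mulrBr -/s -/s' gE.
rewrite leNgt => /negP; apply; rewrite normrM (gtr0_norm g0).
apply: lt_le_trans rhoe; apply: (@lt_le_trans _ _ (g * (rho * l))).
  by rewrite ltr_pM2l // ltr_norml; clear -xl xu; lra.
apply: le_trans (ler_wpM2r (ltW rl0) gu) _.
rewrite -/T [leLHS](_ : _ = 4 * (T * rho) * (4 ^+ k * l)); last by ring.
rewrite [leRHS](_ : _ = 4 * (T * rho) * (4 * (4 * A))); last by ring.
by rewrite ler_pM2l // mulr_gt0 // mulr_gt0.
Qed.

Lemma expr4_balance (x y : R) : 0 < x -> 0 < y -> exists i j : nat,
  4 ^+ j * x <= 4 ^+ i * y <= 4 * (4 ^+ j * x).
Proof.
move=> x0 y0; have [xy|/ltW yx] := leP x y.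
  have [j /andP[j1 j2]] : exists j, y / x <= 4 ^+ j <= 4 * (y / x).
    by apply: expr4_bracket; rewrite ler_pdivlMr // mul1r.
  rewrite ler_pdivrMr // in j1; rewrite mulrA ler_pdivlMr // in j2.
  by exists 1%N, j; rewrite expr1; lra.
have [i /andP[i1 i2]] : exists i, x / y <= 4 ^+ i <= 4 * (x / y).
  by apply: expr4_bracket; rewrite ler_pdivlMr // mul1r.
rewrite ler_pdivrMr // in i1; rewrite mulrA ler_pdivlMr // in i2.
by exists i, 0%N; rewrite expr0; lra.
Qed.

(** The window means [4 ^ j * h <= 4 ^ i * (1 - h) <= 4 * (4 ^ j * h)]; its bounds differ by a
    factor 4, so some power [4 ^ (i - j)] fits. *)
Lemma level_window (h : R) : 0 < h < 1 -> exists i j : nat,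
  4 ^+ i / (4 ^+ i + 4 * 4 ^+ j) <= h <= 4 ^+ i / (4 ^+ i + 4 ^+ j).
Proof.
move=> /andP[h0 h1]; have h1' : 0 < 1 - h by lra.
have [i [j ij]] := expr4_balance h0 h1'.
exists i, j; have s0 : 0 < 4 ^+ i :> R by apply: exprn_gt0.
have s'0 : 0 < 4 ^+ j :> R by apply: exprn_gt0.
by rewrite ler_pdivrMr ?ler_pdivlMr; lra.
Qed.

End Porosity.

Lemma exists_natSinv_lt (R : realType) (e : R) : 0 < e -> exists n : nat, n.+1%:R^-1 < e.
Proof. by move=> /ltr_add_invr[n]; rewrite add0r; exists n. Qed.

(** * Passage to Lebesgue measure and Fubini's theorem *)

Section PlanarMeasure.
Variable R : realType.
Local Notation E := (@setE_real R).
Local Notation mu := (@lebesgue_measure R).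
Local Notation RM := (measurableTypeR R).

Lemma covered_measurable (A : set R) (m : R) : covered A m ->
  exists C : set RM, [/\ measurable C, A `<=` C & (mu C <= m%:E)%E].
Proof.
move=> [s [s0 As sm]].
suff [C [mC sC muC]] : exists C : set RM, [/\ measurable C,
    [set x | has (fun i => i.1 <= x <= i.1 + i.2) s] `<=` C &
    (mu C <= (\sum_(i <- s) i.2)%:E)%E].
  exists C; split=> //; first exact: subset_trans sC.
  by apply: (le_trans muC); rewrite lee_fin.
elim: s s0 {A As sm} => [|[a l] s IHs] /=.
  by move=> _; exists set0; split=> //; rewrite big_nil measure0.
move=> /andP[l0 /IHs [C [mC sC muC]]].
have mI : measurable ([set` `[a, a + l]] : set RM) by apply: measurable_itv.
exists ([set` `[a, a + l]] `|` C); split; first exact: measurableU.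
  move=> x /= /orP[xI|xs]; [left|by right; apply: sC].
  by rewrite in_itv.
apply: (le_trans (measureU2 _ mI mC)).
rewrite big_cons EFinD; apply: leeD => //=.
rewrite lebesgue_measure_itv /= lte_fin ltrDl; case: ifP => _ //.
by rewrite -EFinD addrC addKr.
Qed.

Lemma content_zero_negligible (A : set R) : content_zero A -> mu.-negligible A.
Proof.
move=> A0.
have /choice[C HC] : forall n : nat, exists C : set RM,
    [/\ measurable C, A `<=` C & (mu C <= (n.+1%:R^-1)%:E)%E].
  by move=> n; apply: covered_measurable; apply: A0; rewrite invr_gt0 ltr0n.
have mC : measurable (\bigcap_n C n) by apply: bigcapT_measurable => n; case: (HC n).
exists (\bigcap_n C n); split=> //; last by move=> x Ax n _; case: (HC n) => _ /(_ _ Ax).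
apply/eqP; rewrite eq_le measure_ge0 andbT; apply/lee_addgt0Pr => e e0; rewrite add0e.
have [n ne] := exists_natSinv_lt e0.
case: (HC n) => mCn _ muCn.
apply: (@le_trans _ _ (mu (C n))).
  by apply: le_measure; rewrite ?inE // => x; apply.
by apply: (le_trans muCn); rewrite lee_fin ltW.
Qed.

(** An exceptional level is separated for some [1 / (n + 1)] and lies in some window, so countably
    many null sets suffice. *)
Lemma negligible_exceptional_levels :
  mu.-negligible [set h : RM | 0 <= h <= 1 /\ ~ content_zero (sumset (1 - h) (2 * h))].
Proof.
pose F n i j : set RM := level_separated n.+1%:R^-1 `&`
  [set h | 4 ^+ i / (4 ^+ i + 4 * 4 ^+ j) <= h <= 4 ^+ i / (4 ^+ i + 4 ^+ j)].
apply: (@negligibleS _ _ _ _ (\bigcup_n \bigcup_i \bigcup_j F n i j)); last first.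
  do 3! apply: negligible_bigcup => ?.
  by apply: content_zero_negligible; apply: content_zero_level_separated; rewrite invr_gt0 ltr0n.
move=> h [/andP[h0 h1] nz].
have [e [e0 sep]] : exists e, 0 < e /\ digit_separated e (1 - h) (2 * h).
  apply: contrapT => H; apply: nz; apply: content_zero_sumset; [lra|lra|].
  by move=> e e0 sep; apply: H; exists e.
(* At [h = 0] or [h = 1] one coefficient vanishes and two distinct pieces of level 1 coincide. *)
have h01 : 0 < h < 1.
  have b0 := base4S false (mem_head 0%N [::] : 0%N \in base4 0).
  have b1 := base4S true (mem_head 0%N [::] : 0%N \in base4 0).
  rewrite lt_neqAle h0 andbT [h < 1]lt_neqAle h1 andbT; apply/andP; split; apply/eqP => hE.
    have := sep _ _ _ _ _ b0 b0 b0 b1 ltac:(by []).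
    by rewrite -hE /= subrr mulr0 mulr0 mul0r addr0 normr0 leNgt e0.
  have := sep _ _ _ _ _ b0 b1 b0 b0 ltac:(by []).
  by rewrite hE /= !subrr !mulr0 mul0r addr0 normr0 leNgt e0.
have [n ne] := exists_natSinv_lt e0.
have [i [j ij]] := level_window h01.
exists n => //; exists i => //; exists j => //; split=> //.
move=> k a1 a2 b1 b2 ka1 ka2 kb1 kb2 ab; apply: le_trans (ltW ne) _.
exact: (sep k a1 a2 b1 b2 ka1 ka2 kb1 kb2 ab).
Qed.

(** A Borel set containing [setB], made of truncated expansions. The tail left out is
    [((1 - h) * x' + 2 * h * y') / 4 ^ k] with [x'], [y'] in [[0, 1]], hence the error
    [2 / 4 ^+ k]. *)
Definition digit_cover : set (RM * RM) := [set p | 0 <= p.2 <= 1 /\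
  forall k, exists a b, [/\ a \in base4 k, b \in base4 k &
    `|p.1 - ((1 - p.2) * (a%:R / 4 ^+ k) + 2 * p.2 * (b%:R / 4 ^+ k))| <= 2 / 4 ^+ k]].

Lemma measurable_digit_cover : measurable digit_cover.
Proof.
have -> : digit_cover = [set p | 0 <= p.2] `&` [set p | p.2 <= 1] `&`
   \bigcap_k \bigcup_a \bigcup_b (if (a \in base4 k) && (b \in base4 k) then
   [set p | `|p.1 - ((1 - p.2) * (a%:R / 4 ^+ k) + 2 * p.2 * (b%:R / 4 ^+ k))|
              <= 2 / 4 ^+ k] else set0).
  apply/seteqP; split=> [p [/andP[p0 p1] H]|p [[/= p0 p1] H]].
    split=> // k _; have [a [b [ka kb pab]]] := H k.
    by exists a => //; exists b => //; rewrite ka kb.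
  split=> [|k]; first by rewrite p0.
  have [a _ [b _]] := H k I; case: ifP => // /andP[ka kb] pab.
  by exists a, b.
have mle (f g : RM * RM -> R) : measurable_fun setT f -> measurable_fun setT g ->
    measurable [set p | f p <= g p].
  by move=> mf mg; rewrite -[X in measurable X]setTI; apply: measurable_fun_le.
apply: measurableI; first by apply: measurableI; apply: mle.
apply: bigcapT_measurable => k; apply: bigcupT_measurable => a.
apply: bigcupT_measurable => b; case: ifP => // _; apply: mle => //.
apply: measurableT_comp => //; apply: measurable_funB => //.
apply: measurable_funD; apply: measurable_funM => //.
  exact: measurable_funB.
exact: measurable_funM.
Qed.

(** Truncations are themselves points of [E], so the slice is within [2 / 4 ^+ k] of the sumset for
    every [k], and [k] may depend on [N]. *)
Lemma ysection_digit_cover (h : R) : content_zero (sumset (1 - h) (2 * h)) ->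
  content_zero (ysection digit_cover h).
Proof.
move=> K0 e e0; have [N N0 thick] := covered_thicken (K0 (e / 2) ltac:(lra)).
have [k Nk] := expr4_unbounded (4 * N / e).
have k40 : 0 < 4 ^+ k :> R by apply: exprn_gt0.
apply: (@covered_le _ _ (e / 2 + N * (2 / 4 ^+ k))).
  rewrite ler_pdivrMr // in Nk.
  have : N * (2 / 4 ^+ k) <= e / 2 by rewrite mulrA ler_pdivrMr //; lra.
  lra.
have d0 : 0 <= 2 / 4 ^+ k :> R by apply: ltW; apply: divr_gt0.
apply: covered_sub (thick _ d0) => x; rewrite /ysection /= inE => -[_ /(_ k)].
move=> [a [b [ka kb xab]]]; eexists; last exact: xab.
exists (a%:R / 4 ^+ k), (b%:R / 4 ^+ k); split=> //=.
  by have := setE_real_base4 ka (setE_real0 R); rewrite addr0.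
by have := setE_real_base4 kb (setE_real0 R); rewrite addr0.
Qed.

Lemma digit_cover_null : (mu \x mu)%E digit_cover = 0%E.
Proof.
(* By uniqueness of the product measure, slices may be taken at a fixed second coordinate, the
   height. *)
rewrite (product_measure_unique (m' := (mu \x^ mu)%E)); last 2 first.
- by move=> A B mA mB; apply: product_measure2E.
- exact: measurable_digit_cover.
rewrite /product_measure2 /= -[RHS](integral0 mu setT).
apply: ge0_ae_eq_integral => //.
  by apply: measurable_fun_ysection; apply: measurable_digit_cover.
apply: negligibleS negligible_exceptional_levels => h /= /not_implyP[_ nh].
have [h01|h01] := boolP (0 <= h <= 1); last first.
  exfalso; apply: nh; rewrite /cst (_ : ysection _ _ = set0) ?measure0 //.
  apply/seteqP; split=> x //; rewrite /ysection /= inE => -[h01' _].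
  by move: h01; rewrite h01'.
split=> // h0; apply: nh; apply/negligibleP.
  by apply: measurable_ysection; apply: measurable_digit_cover.
by apply: content_zero_negligible; apply: ysection_digit_cover.
Qed.

End PlanarMeasure.

(** * Null set and segments in the complex plane *)

Section Besicovitch.
Variable R : realType.
Local Open Scope complex_scope.

Lemma natrC2 : 2 = (2 : R)%:C :> R[i].
Proof. by rewrite (rmorph_nat (real_complex R)). Qed.

Lemma segment_coordinates (x y h : R) :
  (1 - h%:C) * x%:C + h%:C * (2 * y%:C + 'i) = ((1 - h) * x + 2 * h * y) +i* h.
Proof.
by rewrite natrC2 /real_complex_def; simpc; congr (_ +i* _); ring.
Qed.

Lemma planar_null_setB : planar_null (@setB R).
Proof.
exists (@digit_cover R); split.
- exact: measurable_digit_cover.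
- exact: digit_cover_null.
move=> [p1 p2] /= [_ [_ [h [[x Ex <-] [_ [y Ey <-] <-] h01]]]].
rewrite segment_coordinates => -[-> ->]; split=> //= k.
have [a ka [x' /setE_real_itv Ex' ->]] := setE_real_split k Ex.
have [b kb [y' /setE_real_itv Ey' ->]] := setE_real_split k Ey.
exists a, b; split=> //.
rewrite (_ : _ - _ = ((1 - h) * x' + 2 * h * y') / 4 ^+ k); last by ring.
have k40 : 0 < 4 ^+ k :> R by apply: exprn_gt0.
rewrite normrM normfV (gtr0_norm k40) ler_pM2r ?invr_gt0 //.
by rewrite ger0_norm; nra.
Qed.

(** Since [|a / b| < 1 / 3], it equals [2 * y - x] with [x], [y] in [E], and the vector from [x] to
    [2 * y + i] is [b^-1] times the direction. *)
Lemma setB_contains_segment (a b : R) : `|a| < 1 / 4 -> `|b - 1| < 1 / 4 ->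
  contains_segment_in_direction (@setB R) (a +i* b).
Proof.
rewrite !ltr_norml => a4 b4; have b0 : 0 < b by lra.
have [x [y [Ex Ey abE]]] : exists x y, [/\ setE_real x, setE_real y & a / b = 2 * y - x].
  by apply: setE_real_diff; rewrite ler_pdivlMr ?ler_pdivrMr //; lra.
exists x%:C, (2 * y%:C + 'i); split.
  exists b^-1; first by rewrite invr_gt0.
  rewrite natrC2 /real_complex_def; simpc; rewrite mulVf ?lt0r_neq0 //.
  by rewrite [b^-1 * a]mulrC abE.
move=> _ [h h01 <-]; exists x%:C, (2 * y%:C + 'i), h; split=> //.
  by exists x.
by exists y%:C => //; exists y.
Qed.

End Besicovitch.

Theorem mainTheorem1 (R : realType) : wide_besicovitch (@setB R).
Proof.
split; first exact: planar_null_setB.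
(* The directions within [1 / 4] of [i]: both coordinates then satisfy the bounds of
   [setB_contains_segment]. *)
pose V : set R[i]^o := [set u | `|'i%C - u| < (1 / 4)%:C%C].
exists (V `&` @unit_circle R); split.
- exists V => //; have := @ball_open _ R[i]^o 'i%C (1 / 4)%:C%C.
  by rewrite -ball_normE.
- exists 'i%C; split; last by rewrite /unit_circle /= normc_def /= expr0n expr1n add0r sqrtr1.
  by rewrite /V /= subrr normr0 ltcR; lra.
move=> [a b] [Vu _].
have {}Vu : Num.sqrt ((- a) ^+ 2 + (1 - b) ^+ 2) < 1 / 4.
  by move: Vu; rewrite /V /= normc_def ltcR /= sub0r.
apply: setB_contains_segment; apply: le_lt_trans Vu.
  by rewrite -normrN -sqrtr_sqr ler_sqrt ?addr_ge0 ?sqr_ge0 // lerDl sqr_ge0.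
by rewrite distrC -sqrtr_sqr ler_sqrt ?addr_ge0 ?sqr_ge0 // lerDr sqr_ge0.
Qed.
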